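(* Let the cone $\mathcal K$ and the vector field $\bar g$ satisfy the conditions given in the context, and let $\alpha^*$ be the parameter defined in the context. Then $\alpha^*<1$.
   Context: CONE CONDITIONS. $\mathcal S$ is a nonempty domain in the unit sphere $S^{d-1}$ of $\mathbb R^d$ and $\mathcal K:=\{rz:z\in\mathcal S,\ r>0\}$; $n^{\mathcal K}(x)$ is the unit inward normal to $\overline{\mathcal K}$ at $x\in\partial\mathcal K\setminus\{0\}$, $v^r(x):=x/|x|$. $\bar g:\partial\mathcal S\to\mathbb R^d$ is a unit vector field, extended to $\partial\mathcal K\setminus\{0\}$ by $\bar g(x):=\bar g(x/|x|)$, and $\inf_{x\in\partial\mathcal K\setminus\{0\}}\bar g(x)\cdot n^{\mathcal K}(x)>0$. For $d=2$: in polar coordinates $\mathcal K=\{(r,z):r>0,\ 0<z<\zeta\}$ with $0<\zeta<2\pi$, and $\bar g$ is a constant vector $\bar g^1$ on $\partial_1\mathcal K=\{z=0,r>0\}$ and a constant vector $\bar g^2$ on $\partial_2\mathcal K=\{z=\zeta,r>0\}$. For $d\ge3$: the boundary $\partial\mathcal S$ of $\mathcal S$ in $S^{d-1}$ is of class $\mathcal C^3$, $\bar g$ is of class $\mathcal C^2$ and, on $\partial\mathcal K\setminus\{0\}$, $\frac{\bar g\cdot v^r}{\bar g\cdot n^{\mathcal K}}$ is of class $\mathcal C^3$ and $\frac{\bar g-(\bar g\cdot v^r)v^r-(\bar g\cdot n^{\mathcal K})n^{\mathcal K}}{\bar g\cdot n^{\mathcal K}}$ is of class $\mathcal C^4$.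 In addition, with $G(0)$ the closed convex cone generated by $\{\bar g(z):z\in\partial\mathcal S\}$ and $N(0):=\{n\in\mathbb R^d:n\cdot x\ge0\ \forall x\in\overline{\mathcal K}\}$: $G(0)\cap\mathcal K\neq\emptyset$, and there is a unit vector $e\in N(0)$ with $\inf_{u\in G(0),|u|=1}e\cdot u>0$. DEFINITION OF $\alpha^*$. For $d=2$: let $n^1,n^2$ be the unit inward normals on $\partial_1\mathcal K,\partial_2\mathcal K$, and let $\zeta_1$ (resp. $\zeta_2$) be the angle between $\bar g^1$ and $n^1$ (resp. $\bar g^2$ and $n^2$), taken to be positive if $\bar g^1$ (resp. $\bar g^2$) points towards the origin; then $\alpha^*:=(\zeta_1+\zeta_2)/\zeta$. For $d\ge3$: write $\bar g=\bar g_rv^r+\bar g_T$ with $\bar g_r=\bar g\cdot v^r$ and $\bar g_T$ tangential to $S^{d-1}$. By Kwon and Williams (1991), for each $\alpha\in\mathbb R$ there are a (unique) $\lambda(\alpha)\in\mathbb R$ and a strictly positive $\psi_\alpha\in\mathcal C^2(\overline{\mathcal S})$ such that $\lambda(\alpha)\psi_\alpha+\Delta_{S^{d-1}}\psi_\alpha=0$ in $\mathcal S$ and $\alpha\bar g_r\psi_\alpha+\bar g_T\cdot\nabla_{S^{d-1}}\psi_\alpha=0$ on $\partial\mathcal S$; $\lambda$ is analytic and concave with $\lambda(0)=0$. If $\lambda'(0)\ne d-2$, there is a unique $\alpha^*\ne0$ with $\lambda(\alpha^* )=\alpha^*(\alpha^*+d-2)$; if $\lambda'(0)=d-2$, set $\alpha^*:=0$.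 *)

(* Defs.v *)
From HB Require Import structures.
From mathcomp Require Import all_boot all_order all_algebra.
From mathcomp Require Import all_classical all_reals all_analysis.
Set Implicit Arguments.
Unset Strict Implicit.
Unset Printing Implicit Defensive.
Import Order.TTheory GRing.Theory Num.Theory.
Import numFieldNormedType.Exports.
Local Open Scope classical_set_scope.
Local Open Scope ring_scope.

(* R^d is 'rV[R]_d.  The library norm `|x| on 'rV is
   the sup norm; it is used only through the topology and differentiability
   it induces. *)

Section Euclidean.
Context {R : realType} {d : nat}.
Implicit Types (x y u : 'rV[R]_d) (A : set 'rV[R]_d).

Definition dot x y : R := \sum_(i < d) x 0 i * y 0 i.
Definition enorm x : R := Num.sqrt (dot x x).

Definition usphere : set 'rV[R]_d := [set x | enorm x = 1].

Definition vr x : 'rV[R]_d := (enorm x)^-1 *: x.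

Definition bnd A : set 'rV[R]_d := closure A `\` interior A.

(* boundary, relative to the unit sphere, of a subset of the unit sphere *)
Definition sbnd A : set 'rV[R]_d := closure A `&` closure (usphere `\` A).

Definition sphere_domain A : Prop :=
  [/\ A !=set0, connected A &
      exists2 U : set 'rV[R]_d, open U & A = U `&` usphere].

Definition cone A : set 'rV[R]_d :=
  [set x | exists2 r : R, 0 < r & exists2 z, A z & x = r *: z].

Definition convex_cone A : Prop :=
  A 0 /\ forall (a b : R) x y,
    0 <= a -> 0 <= b -> A x -> A y -> A (a *: x + b *: y).

Definition closed_convex_cone_hull A : set 'rV[R]_d :=
  smallest (fun C => closed C /\ convex_cone C) A.

(* 0-homogeneous extension of a field given on (part of) the sphere *)
Definition hext {T : Type} (f : 'rV[R]_d -> T) : 'rV[R]_d -> T :=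
  fun x => f (vr x).

(* meaningful for U open *)
Fixpoint Ck (k : nat) {V : normedModType R} (U : set 'rV[R]_d)
    (f : 'rV[R]_d -> V) : Prop :=
  match k with
  | 0%N => forall x, U x -> {for x, continuous f}
  | k'.+1 => (forall x, U x -> differentiable f x) /\
             forall v : 'rV[R]_d, Ck k' U (fun x => 'D_v f x)
  end.

(* f is of class C^k on an arbitrary subset A of R^d: near each point of A it
   is the restriction of a C^k function of d variables; only the values of f
   on A matter. *)
Definition Ck_on (k : nat) {V : normedModType R} A
    (f : 'rV[R]_d -> V) : Prop :=
  forall x, A x -> exists (U : set 'rV[R]_d) (F : 'rV[R]_d -> V),
    [/\ open U, U x, Ck k U F & forall y, U y -> A y -> F y = f y].

Definition grad (f : 'rV[R]_d -> R) x : 'rV[R]_d :=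
  \row_(i < d) 'D_(delta_mx 0 i) f x.

Definition laplacian (f : 'rV[R]_d -> R) x : R :=
  \sum_(i < d) 'D_(delta_mx 0 i) (fun y => 'D_(delta_mx 0 i) f y) x.

(* On the unit sphere, the tangential gradient and the Laplace-Beltrami
   operator are the Euclidean gradient and Laplacian of the 0-homogeneous
   extension. *)
Definition sgrad (f : 'rV[R]_d -> R) : 'rV[R]_d -> 'rV[R]_d := grad (hext f).
Definition slaplacian (f : 'rV[R]_d -> R) : 'rV[R]_d -> R :=
  laplacian (hext f).

(* The boundary of A in the sphere is of class C^k: A is locally the positivity
   set of a C^k function whose tangential gradient does not vanish. *)
Definition Ck_sphere_boundary (k : nat) A : Prop :=
  forall z, sbnd A z -> exists (U : set 'rV[R]_d) (rho : 'rV[R]_d -> R),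
    [/\ open U, U z, Ck k U rho, sgrad rho z != 0 &
        forall y, U y -> usphere y ->
          (A y <-> 0 < rho y) /\ (sbnd A y <-> rho y = 0)].

(* n is the normalized gradient, at the boundary point x, of a local defining
   function that is positive inside A. *)
Definition unit_inward_normal A x (n : 'rV[R]_d) : Prop :=
  enorm n = 1 /\
  exists (U : set 'rV[R]_d) (rho : 'rV[R]_d -> R),
    [/\ open U, U x, Ck 1 U rho,
        forall y, U y -> (A y <-> 0 < rho y) /\ (bnd A y <-> rho y = 0) &
        exists2 c : R, 0 < c & grad rho x = c *: n].

End Euclidean.

Section Cone.
Context {R : realType} {d : nat}.
Implicit Types (S : set 'rV[R]_d) (g n : 'rV[R]_d -> 'rV[R]_d).

Definition polar (r z : R) : 'rV[R]_d :=
  \row_(i < d) if i == 0%N :> nat then r * cos z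
               else if i == 1%N :> nat then r * sin z else 0.

Definition dcone S : set 'rV[R]_d := bnd (cone S) `\ 0.

(* for d = 2: the cone over S is the sector of opening zeta whose first side
   is the positive first coordinate axis *)
Definition sector S (zeta : R) : Prop :=
  0 < zeta < 2 * pi /\
  cone S = [set x | exists r z : R, [/\ 0 < r, 0 < z < zeta & x = polar r z]].

Definition G0 S g : set 'rV[R]_d := closed_convex_cone_hull (g @` sbnd S).
Definition N0 S : set 'rV[R]_d :=
  [set n | forall x, closure (cone S) x -> 0 <= dot n x].

(* The vector field g is given on sbnd S and extended to dcone S by hext;
   n is the unit inward normal field on dcone S.  Infima are taken in the
   extended reals, so that the infimum over the empty set is +oo.  For d = 2,
   dcone S consists of two rays, on each of which hext g is automatically
   constant. *)
Record cone_conditions S g n : Prop := ConeConditions {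
  cc_domain : S `<=` usphere /\ sphere_domain S ;
  cc_normal : forall x, dcone S x -> unit_inward_normal (cone S) x (n x) ;
  cc_unit : forall z, sbnd S z -> enorm (g z) = 1 ;
  cc_oblique :
    (0 < ereal_inf [set (dot (hext g x) (n x))%:E | x in dcone S])%E ;
  cc_planar : d = 2%N -> exists zeta, sector S zeta ;
  cc_smooth : (3 <= d)%N ->
    [/\ Ck_sphere_boundary 3 S,
        Ck_on 2 (sbnd S) g,
        Ck_on 3 (dcone S)
          (fun x => dot (hext g x) (vr x) / dot (hext g x) (n x)) &
        Ck_on 4 (dcone S)
          (fun x => (dot (hext g x) (n x))^-1 *:
             (hext g x - dot (hext g x) (vr x) *: vr x
                       - dot (hext g x) (n x) *: n x))] ;
  cc_meet : G0 S g `&` cone S !=set0 ;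
  cc_dual : exists e : 'rV[R]_d, [/\ enorm e = 1, N0 S e &
    (0 < ereal_inf [set (dot e u)%:E | u in G0 S g `&` usphere])%E]
}.

(* angle between the unit vectors u and m, counted positively when u points
   towards the origin at the points of the ray directed by v *)
Definition signed_angle (u m v : 'rV[R]_d) : R :=
  if dot u v < 0 then acos (dot u m) else - acos (dot u m).

Definition radial g (z : 'rV[R]_d) : R := dot (g z) (vr z).
Definition tangential g (z : 'rV[R]_d) : 'rV[R]_d :=
  g z - radial g z *: vr z.

(* lam is the eigenvalue lambda(alpha).  A function of class C^2 on the compact
   set closure S is represented by an extension psi which is C^2 on an open
   neighbourhood U of it; the boundary values of its derivatives do not depend
   on the extension. *)
Definition oblique_eigenvalue S g (alpha lam : R) : Prop :=
  exists (U : set 'rV[R]_d) (psi : 'rV[R]_d -> R),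
    [/\ open U /\ closure S `<=` U,
        Ck 2 U psi,
        forall z, closure S z -> 0 < psi z,
        forall z, S z -> lam * psi z + slaplacian psi z = 0 &
        forall z, sbnd S z ->
          alpha * radial g z * psi z + dot (tangential g z) (sgrad psi z) = 0].

Definition alpha_star_planar S g n (alpha : R) : Prop :=
  exists zeta, sector S zeta /\
    let z1 := signed_angle (g (polar 1 0)) (n (polar 1 0)) (polar 1 0) in
    let z2 := signed_angle (g (polar 1 zeta)) (n (polar 1 zeta))
                           (polar 1 zeta) in
    alpha = (z1 + z2) / zeta.

(* alpha * (alpha + d - 2) is the value of lambda(alpha) for which
   |x|^alpha psi_alpha(x/|x|) is harmonic *)
Definition alpha_star_eigen S g (alpha : R) : Prop :=
  exists lambda : R -> R,
    (forall a, oblique_eigenvalue S g a (lambda a)) /\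
    ((derive1 lambda 0 <> d%:R - 2 /\ alpha <> 0 /\
      lambda alpha = alpha * (alpha + d%:R - 2)) \/
     (derive1 lambda 0 = d%:R - 2 /\ alpha = 0)).

Definition is_alpha_star S g n (alpha : R) : Prop :=
  (d = 2%N /\ alpha_star_planar S g n alpha) \/
  ((3 <= d)%N /\ alpha_star_eigen S g alpha).

End Cone.

(* Main.v *)
Require Import Defs.
From HB Require Import structures.
From mathcomp Require Import all_boot all_order all_algebra.
From mathcomp Require Import all_classical all_reals all_analysis.
From mathcomp Require Import ring lra.
Import Order.TTheory GRing.Theory Num.Theory.
Import numFieldNormedType.Exports.
Local Open Scope classical_set_scope.
Local Open Scope ring_scope.

(** For [3 <= d], suppose [1 <= alpha] and write [h] for the 0-homogeneous
    extension of [psi_alpha], so that |x|^alpha h(x) is harmonic and has zero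
    derivative along [g] on the boundary of the cone.  Compare it with
    P(x) = e.x + eps |x|, where [e] is the dual vector and [eps] is so small that
    the derivative of [P] along [g] is positive on the boundary.  The function
    F = alpha ln P - ln (|x|^alpha h) is 0-homogeneous, hence attains its
    maximum over the closed cone.  It increases along [g], which points inwards, so
    the maximum is not on the boundary; at an interior critical point the
    Laplacian of [F] is alpha eps (d-1)/P + alpha (alpha-1) |grad P / P|^2 > 0.
    This avoids the concavity of [lambda] altogether.

    For [d = 2], write e = (cos phi, sin phi).  Since [e] is in N(0), both [phi]
    and [zeta - phi] lie in [-pi/2, pi/2].  Then e.g^1 = sin (phi - zeta_1) and
    e.g^2 = sin (zeta - phi - zeta_2) are positive, so zeta_1 < phi and
    zeta_2 < zeta - phi. *)

Set Implicit Arguments.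
Unset Strict Implicit.

(** * Euclidean inner product, norm and radial projection *)

Section EuclideanNorm.
Context {R : realType} {d : nat}.
Implicit Types (x y z u v : 'rV[R]_d).

Lemma dotC x y : dot x y = dot y x.
Proof. by apply: eq_bigr => i _; rewrite mulrC. Qed.

Lemma dotDl x y z : dot (x + y) z = dot x z + dot y z.
Proof. by rewrite -big_split; apply: eq_bigr => i _; rewrite mxE mulrDl. Qed.

Lemma dotZl (a : R) x y : dot (a *: x) y = a * dot x y.
Proof. by rewrite big_distrr; apply: eq_bigr => i _; rewrite mxE /= mulrA. Qed.

Lemma dotDr x y z : dot z (x + y) = dot z x + dot z y.
Proof. by rewrite dotC dotDl !(dotC z). Qed.

Lemma dotZr (a : R) x y : dot x (a *: y) = a * dot x y.
Proof. by rewrite dotC dotZl (dotC y). Qed.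

Lemma dotNl x y : dot (- x) y = - dot x y.
Proof. by rewrite -scaleN1r dotZl mulN1r. Qed.

Lemma dotNr x y : dot x (- y) = - dot x y.
Proof. by rewrite dotC dotNl dotC. Qed.

Definition dotE := (dotDl, dotDr, dotZl, dotZr, dotNl, dotNr).

Lemma dot0l y : dot 0 y = 0.
Proof. by rewrite -(scale0r 0) dotZl mul0r. Qed.

Lemma dot_delta x (i : 'I_d) : dot x (delta_mx 0 i) = x 0 i.
Proof.
rewrite /dot (bigD1 i) //= mxE !eqxx mulr1 big1 ?addr0 // => j ji.
by rewrite mxE eqxx (negbTE ji) mulr0.
Qed.

Lemma dotxx_ge0 x : 0 <= dot x x.
Proof. by apply: sumr_ge0 => i _; rewrite -expr2 sqr_ge0. Qed.

Lemma dotxx_eq0 x : (dot x x == 0) = (x == 0).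
Proof.
apply/eqP/eqP => [x0|->]; last exact: dot0l.
apply/rowP => i; rewrite mxE; apply/eqP; rewrite -sqrf_eq0 expr2.
have /psumr_eq0P -> // : forall j : 'I_d, true -> 0 <= x 0 j * x 0 j.
by move=> j _; rewrite -expr2 sqr_ge0.
Qed.

Lemma dotxx_gt0 x : (0 < dot x x) = (x != 0).
Proof. by rewrite lt_def dotxx_eq0 dotxx_ge0 andbT. Qed.

Lemma sqr_enorm x : enorm x ^+ 2 = dot x x.
Proof. by rewrite sqr_sqrtr // dotxx_ge0. Qed.

Lemma enorm_gt0 x : (0 < enorm x) = (x != 0).
Proof. by rewrite sqrtr_gt0 dotxx_gt0. Qed.

Lemma enormZ (r : R) x : 0 <= r -> enorm (r *: x) = r * enorm x.
Proof.
move=> r0; rewrite /enorm !dotE mulrA -expr2 sqrtrM ?sqr_ge0 //.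
by rewrite sqrtr_sqr ger0_norm.
Qed.

Lemma enorm1P x : enorm x = 1 <-> dot x x = 1.
Proof.
by rewrite -sqr_enorm; split => [->|/eqP]; rewrite ?expr1n // sqrp_eq1 ?sqrtr_ge0 // => /eqP.
Qed.

Lemma enorm1_neq0 x : enorm x = 1 -> x != 0.
Proof. by move=> x1; rewrite -enorm_gt0 x1. Qed.

Lemma enorm_vr x : x != 0 -> enorm (vr x) = 1.
Proof.
by rewrite -enorm_gt0 => x0; rewrite enormZ ?invr_ge0 ?ltW // mulVf ?gt_eqF.
Qed.

Lemma vr_id x : enorm x = 1 -> vr x = x.
Proof. by move=> x1; rewrite /vr x1 invr1 scale1r. Qed.

Lemma vrZ (r : R) x : 0 < r -> vr (r *: x) = vr x.
Proof.
move=> r0; rewrite /vr enormZ ?ltW // scalerA; congr (_ *: _).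
by rewrite invfM mulrAC mulVf ?mul1r // gt_eqF.
Qed.

(** Expanding the squared norms of [x + y] and [x - y], both nonnegative, gives the two bounds. *)
Lemma dot_unit_le1 x y : enorm x = 1 -> enorm y = 1 -> -1 <= dot x y <= 1.
Proof.
move=> /enorm1P x1 /enorm1P y1.
have := dotxx_ge0 (x - y); have := dotxx_ge0 (x + y).
by rewrite !dotE x1 y1 (dotC y x); lra.
Qed.

Lemma differentiable_dot {V : normedModType R} (f g : V -> 'rV[R]_d) t :
  differentiable f t -> differentiable g t ->
  differentiable (fun s => dot (f s) (g s)) t.
Proof.
move=> df dg.
have -> : (fun s => dot (f s) (g s)) =
    \sum_(i < d) ((fun s => f s 0 i) * (fun s => g s 0 i)).
  by apply/funext => s; rewrite fct_sumE.
apply: differentiable_sum => i; apply: differentiableM.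
  exact: (differentiable_comp df (differentiable_coord _ _ _)).
exact: (differentiable_comp dg (differentiable_coord _ _ _)).
Qed.

Lemma differentiable_enorm x : x != 0 -> differentiable (@enorm R d) x.
Proof.
move=> x0; apply: (@differentiable_comp _ _ _ _ (fun y => dot y y) Num.sqrt).
  exact: differentiable_dot.
apply/derivable1_diffP; apply: ex_derive; apply: is_derive1_sqrt.
by rewrite dotxx_gt0.
Qed.

Lemma differentiable_vr x : x != 0 -> differentiable (@vr R d) x.
Proof.
move=> x0.
have -> : @vr R d = \sum_(i < d) (fun y : 'rV[R]_d =>
    ((fun y => (enorm y)^-1) * (fun y => y 0 i)) y *: (delta_mx 0 i : 'rV[R]_d)).
  apply: funext => y; rewrite fct_sumE /vr {2}(row_sum_delta y) scaler_sumr.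
  by apply: eq_bigr => i _; rewrite scalerA.
apply: differentiable_sum => i; apply: differentiableZl.
apply: differentiableM; last exact: differentiable_coord.
apply: differentiableV; first exact: differentiable_enorm.
by rewrite gt_eqF // enorm_gt0.
Qed.

End EuclideanNorm.

(** * Derivatives along lines and second-order conditions at a maximum *)

(** The two difference quotients are the same function of the increment, so directional derivability
    alone passes to the line. *)
Lemma is_derive_line {R : realType} {V W : normedModType R} (f : V -> W)
    (z v : V) (t : R) (df : W) :
  is_derive (z + t *: v) v f df -> is_derive t (1 : R) (fun s => f (z + s *: v)) df.
Proof.
have E : (fun h : R => h^-1 *: (((fun s => f (z + s *: v)) \o shift t) (h *: (1 : R)) -
      f (z + t *: v))) =
    (fun h : R => h^-1 *: ((f \o shift (z + t *: v)) (h *: v) - f (z + t *: v))).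
  apply: funext => h /=; congr (_ *: (f _ - _)).
  by rewrite [h *: (1 : R)]mulr1 scalerDl addrCA.
by move=> [D1 D2]; split; rewrite /derivable /derive E.
Qed.

Lemma gt0_derive_right {R : realType} (f : R -> R) (a : R) :
  is_derive (0 : R) (1 : R) f a -> 0 < a -> \forall t \near 0^'+, f 0 < f t.
Proof.
move=> [fd fa] a0.
have H : (fun h : R => h^-1 *: (f (h *: (1 : R) + 0) - f 0)) @ 0^' --> a.
  by rewrite -fa; exact: fd.
have : \forall h \near 0^', 0 < h^-1 *: (f (h *: (1 : R) + 0) - f 0) by exact: (cvgr_gt _ H _ a0).
rewrite /dnbhs near_withinE => N.
rewrite /at_right near_withinE; apply: filterS N => t N /= t0.
have := N (lt0r_neq0 t0); rewrite addr0 [t *: (1 : R)]mulr1 /GRing.scale /=.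
by rewrite pmulr_rgt0 ?invr_gt0 // subr_gt0.
Qed.

Lemma near_right_ex {R : realType} (P : R -> Prop) :
  (\forall t \near (0 : R)^'+, P t) -> exists t, P t.
Proof. by move=> /(@filter_ex _ _ (at_right_proper_filter 0)). Qed.

(** The first derivative vanishes by Fermat's rule. If [a] were positive, [f1] would be positive
    just to the right of 0, and the mean value theorem would give a nearby [b] with [f b > f 0]. *)
Lemma local_max_derive2 {R : realType} (f f1 : R -> R) (a : R) :
  (\forall t \near (0 : R), is_derive t (1 : R) f (f1 t)) -> is_derive (0 : R) (1 : R) f1 a ->
  (\forall t \near 0, f t <= f 0) -> f1 0 = 0 /\ a <= 0.
Proof.
move=> fD f1D fmax.
have [e /= e0 He] : \forall t \near 0, is_derive t (1 : R) f (f1 t) /\ f t <= f 0.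
  by near=> t; split; near: t.
have Hb t : t \in `]- e, e[%R -> is_derive t (1 : R) f (f1 t) /\ f t <= f 0.
  by rewrite in_itv => te; apply: He; rewrite /= sub0r normrN ltr_norml.
have f10 : f1 0 = 0.
  have e0i : 0 \in `]- e, e[%R by rewrite in_itv /= oppr_lt0 e0.
  have D : is_derive (0 : R) (1 : R) f 0.
    apply: (@derive1_at_max _ f (- e) e) => //.
    - by rewrite ge0_cp // ltW.
    - by move=> t /Hb[? _]; apply: ex_derive.
    - by move=> t /Hb[].
  have [D' _] := Hb _ e0i.
  by rewrite -(@derive_val _ _ _ _ _ _ _ D') (@derive_val _ _ _ _ _ _ _ D).
split => //; rewrite leNgt; apply/negP => a0.
have [r /= r0 Hr] : \forall t \near 0^'+, f1 0 < f1 t by exact: gt0_derive_right f1D a0.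
(* Halving the minimum keeps the closed interval from 0 to [b] inside both neighbourhoods: the one
   where [f] is derivable and maximal at 0, and the one where [f1] is positive to the right. *)
pose b := Num.min e r / 2.
have b0 : 0 < b by rewrite divr_gt0 // lt_min e0.
have bm : b < Num.min e r by rewrite ltr_pdivrMr // ltr_pMr ?ltr1n // lt_min e0.
move: (bm); rewrite lt_min => /andP[be br].
have bI t : 0 <= t <= b -> t \in `]- e, e[%R.
  by move=> /andP[t0 tb]; rewrite in_itv /=; lra.
have [||c cb Hc] := @MVT _ f f1 0 b b0.
- move=> t; rewrite in_itv /= => /andP[t0 tb].
  by have [|] := Hb t _; first by apply: bI; rewrite !ltW.
- apply: derivable_within_continuous => t; rewrite in_itv /= => tb.
  by have [? _] := Hb t (bI t tb); apply: ex_derive.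
move: cb; rewrite in_itv /= => /andP[c0 cb].
have /bI/Hb[_ fb] : 0 <= b <= b by rewrite lexx ltW.
move: fb.
apply/negP; rewrite -ltNge -subr_gt0 Hc subr0 mulr_gt0 //.
rewrite -f10; apply: Hr => //=.
by rewrite sub0r normrN gtr0_norm // (lt_trans cb).
Unshelve. all: by end_near. Qed.

Lemma differentiable_line {R : realType} {V : normedModType R} (z v : V) (t : R) :
  differentiable (fun s : R => z + s *: v) t.
Proof. exact: ex_diff. Qed.

Lemma differentiable_ln {R : realType} {V : normedModType R} (f : V -> R) (x : V) :
  differentiable f x -> 0 < f x -> differentiable (fun y => ln (f y)) x.
Proof.
move=> fD f0; apply: (differentiable_comp fD).
by apply/derivable1_diffP; apply: ex_derive; exact: is_derive1_ln.
Qed.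

Lemma near_line {R : realType} {V : normedModType R} (z v : V) (A : set V) :
  nbhs z A -> \forall t \near (0 : R), A (z + t *: v).
Proof.
have := differentiable_continuous (@differentiable_line R V z v 0).
by move=> cl zA; apply: cl; rewrite scale0r addr0.
Qed.

(** * Cones over subsets of the sphere, their boundaries and inward directions *)

Section SphericalCone.
Context {R : realType} {d : nat}.
Implicit Types (S A : set 'rV[R]_d) (x y z u v : 'rV[R]_d).

Lemma derive_grad (f : 'rV[R]_d -> R) x v :
  differentiable f x -> 'D_v f x = dot v (grad f x).
Proof.
move=> df; rewrite deriveE // {1}(row_sum_delta v) linear_sum /=.
by apply: eq_bigr => i _; rewrite linearZ mxE -deriveE.
Qed.

Lemma continuous_dot : continuous (fun x => dot x x).
Proof. by move=> x; apply: differentiable_continuous; exact: differentiable_dot. Qed.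

Lemma closed_usphere : closed (@usphere R d).
Proof.
have -> : @usphere R d = (fun x => dot x x) @^-1` [set 1].
  by apply/seteqP; split => x /enorm1P.
exact: (continuous_closedP _).1 continuous_dot _ (@closed_eq _ _).
Qed.

Lemma closure_usphere S : S `<=` @usphere R d -> closure S `<=` @usphere R d.
Proof. by move=> SU; rewrite ((closure_id _).1 closed_usphere); exact: closureS. Qed.

Lemma compact_closure_usphere S : S `<=` @usphere R d -> compact (closure S).
Proof.
move=> SU; apply: bounded_closed_compact; last exact: closed_closure.
(* The norm here is the sup norm; each coordinate is bounded by the Euclidean norm, which is 1 on
   the closure of [S]. *)
exists 1; split => // M M1 x /(closure_usphere SU) /enorm1P x1.
rewrite /= [leLHS]/Num.Def.normr/= mx_normrE.
apply: bigmax_le => [|[i j] _]; first by rewrite ltW // (lt_trans ltr01).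
apply: le_trans (ltW M1); rewrite ord1 /= -(@ler_pXn2r _ 2) ?nnegrE //.
rewrite expr1n -x1 real_normK ?num_real // /dot (bigD1 j) //= -expr2 lerDl.
by apply: sumr_ge0 => k _; rewrite -expr2 sqr_ge0.
Qed.

Lemma coneP S x : S `<=` @usphere R d -> cone S x <-> x != 0 /\ S (vr x).
Proof.
move=> SU; split => [[r r0 [z Sz ->]]|[x0 Sx]].
  have /enorm1_neq0 z0 := SU _ Sz.
  rewrite vrZ // vr_id; last exact: SU.
  by rewrite scaler_eq0 (gt_eqF r0) (negbTE z0).
exists (enorm x); first by rewrite enorm_gt0.
exists (vr x) => //; rewrite /vr scalerA mulfV ?scale1r //.
by rewrite gt_eqF // enorm_gt0.
Qed.

Lemma sub_cone S : S `<=` cone S.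
Proof. by move=> x Sx; exists 1 => //; exists x => //; rewrite scale1r. Qed.

(** If [z] were interior to the cone, all points of the sphere near [z] would lie in [S], although
    [z] is a limit of points of the sphere outside [S]. *)
Lemma sbnd_dcone S : S `<=` @usphere R d -> sbnd S `<=` dcone S.
Proof.
move=> SU z [Sz nSz]; have /enorm1_neq0 z0 := closure_usphere SU Sz.
split; last exact/eqP.
split; first exact: (closureS (@sub_cone S)).
move=> /nSz [y [[Uy nSy] /(coneP _ SU)[_]]].
by rewrite vr_id.
Qed.

Lemma closure_sbnd S z : S `<=` @usphere R d -> closure S z -> ~ S z -> sbnd S z.
Proof.
move=> SU Sz nSz; split => //; apply: subset_closure; split => //.
exact: (closure_usphere SU).
Qed.

Lemma near_vr z A : enorm z = 1 -> nbhs z A -> \forall x \near z, A (vr x).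
Proof.
move=> z1 zA; have := differentiable_continuous (differentiable_vr (enorm1_neq0 z1)).
by apply; rewrite vr_id.
Qed.

(** [S] is relatively open in the sphere, and [vr] is continuous at [z] and fixes it. *)
Lemma sphere_domain_near S z : S `<=` @usphere R d -> sphere_domain S -> S z ->
  \forall x \near z, S (vr x).
Proof.
move=> SU [_ _ [U Uo SE]] Sz; have z1 := SU _ Sz.
have zn : \forall x \near z, 0 < dot x x.
  apply: (cvgr_gt _ (@continuous_dot z)).
  by rewrite dotxx_gt0 enorm1_neq0.
have zU : \forall x \near z, U (vr x).
  by apply: near_vr => //; apply: open_nbhs_nbhs; split => //; move: Sz; rewrite SE => -[].
apply: filterS2 zn zU => x; rewrite dotxx_gt0 SE => x0 Ux; split => //.
exact: enorm_vr.
Qed.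

(** The defining function [rho] vanishes at [z] and has derivative [c * dot v n > 0] along [v], so
    it becomes positive at once. *)
Lemma inward_cone S z n v : dcone S z -> unit_inward_normal (cone S) z n ->
  0 < dot v n -> \forall t \near (0 : R)^'+, cone S (z + t *: v).
Proof.
move=> [bz _] [_ [U [rho [Uo Uz [rd _] rhoE [c c0 gE]]]]] vn.
have rz : rho z = 0 by apply/(rhoE z Uz).2.
have D : is_derive (0 : R) (1 : R) (fun s => rho (z + s *: v)) ('D_v rho z).
  apply: is_derive_line; rewrite scale0r addr0.
  by apply: derivableP; apply: diff_derivable; exact: rd.
have D0 : 0 < 'D_v rho z.
  by rewrite derive_grad ?gE ?dotZr ?mulr_gt0 //; exact: rd.
have R0 := gt0_derive_right D D0.
have cl : {for 0, continuous (fun s : R => z + s *: v)}.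
  exact/differentiable_continuous/differentiable_line.
have U0 : \forall t \near (0 : R)^'+, U (z + t *: v).
  have := cvg_at_right_filter cl; apply; rewrite scale0r addr0.
  exact: open_nbhs_nbhs.
apply: filterS2 R0 U0 => t; rewrite scale0r addr0 rz => rt Ut.
exact/(rhoE _ Ut).1.
Qed.

End SphericalCone.

Lemma ereal_inf_gt0P {R : realType} {T : Type} (A : set T) (f : T -> R) :
  (0 < ereal_inf [set (f x)%:E | x in A])%E ->
  exists2 c : R, 0 < c & forall x, A x -> c <= f x.
Proof.
set m := ereal_inf _ => m0.
have mle x : A x -> (m <= (f x)%:E)%E by move=> Ax; apply: ereal_inf_lbound; exists x.
case: m m0 mle => [c||] //; first by rewrite lte_fin => c0 H; exists c.
(* An infinite infimum forces [A] to be empty, so any positive constant serves. *)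
by move=> _ H; exists 1 => // x /H; rewrite leye_eq.
Qed.

(** * Chain and quotient rules for directional derivatives *)

Section DirectionalCalculus.
Context {R : realType} {V : normedModType R}.
Implicit Types (f g : V -> R) (x v : V).

(** Restricting to the line through [x] in direction [v] reduces this to the one-variable chain
    rule. *)
Lemma is_derive_comp f (k : R -> R) x v (a b : R) :
  is_derive x v f a -> is_derive (f x) (1 : R) k b ->
  is_derive x v (fun y => k (f y)) (b * a).
Proof.
move=> fD kD.
have L : is_derive (0 : R) (1 : R) (fun s => f (x + s *: v)) a.
  by apply: is_derive_line; rewrite scale0r addr0.
have kD' : is_derive (f (x + 0 *: v)) (1 : R) k b by rewrite scale0r addr0.
have [] := is_derive1_comp kD' L.
have E : (fun h : R => h^-1 *: (((fun y => k (f y)) \o shift x) (h *: v) - k (f x))) =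
    (fun h : R => h^-1 *: (((k \o (fun s => f (x + s *: v))) \o shift (0 : R))
      (h *: (1 : R)) - k (f (x + (0 : R) *: v)))).
  apply: funext => h /=.
  by rewrite addr0 [h *: (1 : R)]mulr1 scale0r addr0 (addrC x).
by move=> D1 D2; split; rewrite /derivable /derive E.
Qed.

Lemma is_derive_inv f x v (a : R) :
  is_derive x v f a -> f x != 0 -> is_derive x v (fun y => (f y)^-1) (- (f x) ^- 2 * a).
Proof. by move=> [fD <-] f0; split; [apply: derivableV|rewrite deriveV]. Qed.

Lemma is_derive_div f g x v (a b : R) :
  is_derive x v f a -> is_derive x v g b -> g x != 0 ->
  is_derive x v (fun y => f y / g y) (a / g x - f x * b / g x ^+ 2).
Proof.
move=> fD gD g0; have := is_deriveM fD (is_derive_inv gD g0).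
by move=> D; apply: (is_derive_eq D); rewrite /GRing.scale /=; field.
Qed.

Lemma is_derive_ln f x v (a : R) :
  is_derive x v f a -> 0 < f x -> is_derive x v (fun y => ln (f y)) (a / f x).
Proof.
by move=> fD f0; rewrite mulrC; apply: is_derive_comp; exact: is_derive1_ln.
Qed.

End DirectionalCalculus.

(** * Directional derivatives of coordinates, norm and radial projection *)

Section EuclideanDerivatives.
Context {R : realType} {d : nat}.
Implicit Types (x y z u v e : 'rV[R]_d).

Lemma is_derive_coord x v (i : 'I_d) :
  is_derive x v (fun y : 'rV[R]_d => y 0 i) (v 0 i).
Proof.
apply: DeriveDef; first exact/diff_derivable/differentiable_coord.
have := @derive_mx _ _ _ _ (id : 'rV[R]_d -> 'rV[R]_d) x v (@derivable_id _ _ _ _).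
by rewrite derive_id => /rowP /(_ i); rewrite mxE => <-.
Qed.

Lemma is_derive_dotr e x v : is_derive x v (fun y => dot e y) (dot e v).
Proof.
have -> : (fun y => dot e y) = \sum_(i < d) (e 0 i \*: (fun y : 'rV[R]_d => y 0 i)).
  by apply: funext => y; rewrite fct_sumE.
apply: is_derive_sum => i; apply: is_deriveZ; exact: is_derive_coord.
Qed.

Lemma is_derive_dotxx x v : is_derive x v (fun y => dot y y) (2 * dot x v).
Proof.
have -> : (fun y => dot y y) =
    \sum_(i < d) ((fun y : 'rV[R]_d => y 0 i) * (fun y : 'rV[R]_d => y 0 i)).
  by apply: funext => y; rewrite fct_sumE.
have -> : 2 * dot x v = \sum_(i < d) (x 0 i *: v 0 i + x 0 i *: v 0 i).
  by rewrite big_split /= -mulr2n mulr_natl.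
apply: is_derive_sum => i; apply: is_deriveM; exact: is_derive_coord.
Qed.

Lemma is_derive_enorm x v : x != 0 -> is_derive x v (@enorm R d) (dot x v / enorm x).
Proof.
move=> x0; have xx0 : 0 < dot x x by rewrite dotxx_gt0.
have := is_derive_comp (is_derive_dotxx x v) (is_derive1_sqrt xx0).
move=> D; apply: (is_derive_eq D); rewrite -/(enorm x); have := enorm_gt0 x; rewrite x0 => n0.
by field; rewrite gt_eqF.
Qed.

Lemma derive_vr x v : x != 0 ->
  'D_v (@vr R d) x = (enorm x)^-1 *: v - (dot x v / (dot x x * enorm x)) *: x.
Proof.
move=> x0; have n0 : enorm x != 0 by rewrite gt_eqF // enorm_gt0.
rewrite derive_mx; last exact/diff_derivable/differentiable_vr.
apply/rowP => i; rewrite !mxE.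
have -> : (fun y : 'rV[R]_d => vr y 0 i) = fun y => y 0 i / enorm y.
  by apply: funext => y; rewrite mxE mulrC.
rewrite (@derive_val _ _ _ _ _ _ _
  (is_derive_div (is_derive_coord x v i) (is_derive_enorm v x0) n0)).
by rewrite -sqr_enorm; field.
Qed.

End EuclideanDerivatives.

(** * Regularity of 0-homogeneous extensions *)

Section HomogeneousExtension.
Context {R : realType} {d : nat}.
Implicit Types (x y z u v : 'rV[R]_d) (U : set 'rV[R]_d) (psi : 'rV[R]_d -> R).

Lemma differentiable_hext psi x : x != 0 -> differentiable psi (vr x) ->
  differentiable (hext psi) x.
Proof.
by move=> x0 dpsi; apply: differentiable_comp => //; exact: differentiable_vr.
Qed.

Lemma derive_hext psi x v : x != 0 -> differentiable psi (vr x) ->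
  'D_v (hext psi) x = dot ('D_v (@vr R d) x) (grad psi (vr x)).
Proof.
move=> x0 dpsi; rewrite -derive_grad // !deriveE //; last 2 first.
- exact: differentiable_vr.
- exact: differentiable_hext.
exact: (congr1 (fun f => f v) (diff_comp (differentiable_vr x0) dpsi)).
Qed.

(** The radial derivative of [vr] is zero, so the gradient of a 0-homogeneous function is tangential
    to the sphere. *)
Lemma dot_sgrad_id psi z : enorm z = 1 -> differentiable psi z ->
  dot z (sgrad psi z) = 0.
Proof.
move=> z1 dpsi; have z0 := enorm1_neq0 z1.
rewrite /sgrad -derive_grad; last by apply: differentiable_hext; rewrite // vr_id.
rewrite derive_hext ?vr_id // derive_vr // (enorm1P z).1 // z1 mulr1 invr1.
by rewrite mulr1 subrr dot0l.
Qed.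

(** Near [z] the first derivative is an explicit expression in the norm, inner products and the
    gradient of [psi] at [vr x]; that gradient is differentiable because [psi] is of class C^2. *)
Lemma derivable_derive_hext U psi z v : open U -> Ck 2 U psi -> enorm z = 1 ->
  U z -> derivable (fun x => 'D_v (hext psi) x) z v.
Proof.
move=> Uo [psiD psi2D] z1 Uz; have z0 := enorm1_neq0 z1.
have zU : \forall x \near z, U (vr x) by apply: near_vr => //; exact: open_nbhs_nbhs.
have zn : \forall x \near z, 0 < dot x x.
  by apply: (cvgr_gt _ (@continuous_dot _ _ z)); rewrite dotxx_gt0.
pose G := fun x => grad psi (vr x).
have GD : differentiable G z.
  have -> : G = \sum_(i < d) (fun x =>
      'D_(delta_mx 0 i) psi (vr x) *: (delta_mx 0 i : 'rV[R]_d)).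
    apply: funext => y; rewrite fct_sumE [LHS]row_sum_delta.
    by apply: eq_bigr => i _; rewrite mxE.
  apply: differentiable_sum => i; apply: differentiableZl.
  apply: (@differentiable_comp _ _ _ _ (@vr R d) (fun y => 'D_(delta_mx 0 i) psi y)).
    exact: differentiable_vr.
  by rewrite vr_id //; have [+ _] := psi2D (delta_mx 0 i); apply.
apply: (@near_eq_derivable _ _ _ (fun x =>
  (enorm x)^-1 * dot v (G x) - (dot x v / (dot x x * enorm x)) * dot x (G x))).
  apply: filterS2 zU zn => x Ux; rewrite dotxx_gt0 => x0.
  by rewrite derive_hext ?derive_vr ?dotE ?dotNl ?dotZl //; exact: psiD.
apply: diff_derivable.
have nD := differentiable_enorm z0; have n0 : enorm z != 0 by rewrite gt_eqF // enorm_gt0.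
have cD (u : 'rV[R]_d) : differentiable (fun _ : 'rV[R]_d => u) z by exact: differentiable_cst.
apply: differentiableB.
  by apply: differentiableM; [exact: differentiableV|exact: differentiable_dot].
apply: differentiableM; last exact: differentiable_dot.
apply: differentiableM; first exact: differentiable_dot.
apply: differentiableV; last by rewrite mulf_neq0 // dotxx_eq0.
by apply: differentiableM => //; exact: differentiable_dot.
Qed.

End HomogeneousExtension.

(** * The logarithmic comparison function and its derivatives *)

Section LogRatio.
Context {R : realType} {d : nat}.
Implicit Types (x z v e : 'rV[R]_d) (h : 'rV[R]_d -> R).

(* alpha times the logarithm of the homogeneous degree one comparison function
   e.x + eps |x|, minus that of |x|^alpha h(x). *)
Definition log_ratio e (eps alpha : R) h x : R :=
  alpha * ln (dot e x + eps * enorm x) - alpha * ln (enorm x) - ln (h x).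

Definition dlog_ratio e (eps alpha : R) h v x : R :=
  alpha * ((dot e v + eps * (dot x v / enorm x)) / (dot e x + eps * enorm x))
  - alpha * (dot x v / enorm x / enorm x) - 'D_v h x / h x.

Lemma is_derive_barrier e (eps : R) x v : x != 0 ->
  is_derive x v (fun y => dot e y + eps * enorm y)
    (dot e v + eps * (dot x v / enorm x)).
Proof.
move=> x0; apply: is_deriveD; first exact: is_derive_dotr.
exact: (is_deriveZ _ (is_derive_enorm v x0)).
Qed.

Lemma is_derive_log_ratio e (eps alpha : R) h x v :
  x != 0 -> 0 < dot e x + eps * enorm x -> 0 < h x -> derivable h x v ->
  is_derive x v (log_ratio e eps alpha h) (dlog_ratio e eps alpha h v x).
Proof.
move=> x0 P0 h0 hD.
have n0 : 0 < enorm x by rewrite enorm_gt0.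
apply: is_deriveB; last exact: is_derive_ln (derivableP hD) h0.
apply: is_deriveB.
  exact: (is_deriveZ alpha (is_derive_ln (is_derive_barrier e eps v x0) P0)).
exact: (is_deriveZ alpha (is_derive_ln (is_derive_enorm v x0) n0)).
Qed.

(** At a unit vector, [dot v v - dot z v ^+ 2] is the second derivative of the norm along [v], and
    [dot v v - 2 * dot z v ^+ 2] that of its logarithm. *)
Lemma is_derive_dlog_ratio e (eps alpha : R) h z v :
  enorm z = 1 -> 0 < dot e z + eps -> 0 < h z ->
  derivable h z v -> derivable (fun x => 'D_v h x) z v ->
  is_derive z v (dlog_ratio e eps alpha h v)
    (alpha * (eps * (dot v v - dot z v ^+ 2) / (dot e z + eps)
              - ((dot e v + eps * dot z v) / (dot e z + eps)) ^+ 2)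
     - alpha * (dot v v - 2 * dot z v ^+ 2)
     - ('D_v (fun x => 'D_v h x) z / h z - ('D_v h z / h z) ^+ 2)).
Proof.
move=> z1 P0 h0 hD h2D.
have z0 := enorm1_neq0 z1.
have n0 : enorm z != 0 by rewrite z1 oner_neq0.
have P0' : dot e z + eps * enorm z != 0 by rewrite z1 mulr1 gt_eqF.
have dz : is_derive z v (fun x => dot x v) (dot v v).
  have -> : (fun x => dot x v) = (fun x => dot v x) by apply: funext => x; rewrite dotC.
  exact: is_derive_dotr.
have nz := is_derive_enorm v z0.
have qz := is_derive_div dz nz n0.
have bz := is_derive_barrier e eps v z0.
have cz : is_derive z v (fun x => dot e v + eps * (dot x v / enorm x))
    (0 + eps * (dot v v / enorm z - dot z v * (dot z v / enorm z) / enorm z ^+ 2)).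
  exact: (is_deriveD (is_derive_cst _ _ _) (is_deriveZ eps qz)).
have Az := is_deriveZ alpha (is_derive_div cz bz P0').
have Bz := is_deriveZ alpha (is_derive_div qz nz n0).
have Cz := is_derive_div (derivableP h2D) (derivableP hD) (lt0r_neq0 h0).
apply: (is_derive_eq (is_deriveB (is_deriveB Az Bz) Cz)).
rewrite /GRing.scale /= z1; field.
by rewrite !gt_eqF.
Qed.

(** The barrier is homogeneous of degree one, so its logarithm contributes [alpha * ln (enorm x)],
    which the second term cancels; [hext psi] has degree zero. *)
Lemma log_ratio_vr e (eps alpha : R) psi x : x != 0 ->
  0 < dot e (vr x) + eps ->
  log_ratio e eps alpha (hext psi) x = log_ratio e eps alpha (hext psi) (vr x).
Proof.
move=> x0 P0; have n0 : 0 < enorm x by rewrite enorm_gt0.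
have v1 := enorm_vr x0.
rewrite /log_ratio /hext v1 mulr1 ln1 mulr0 subr0 (vr_id v1).
have -> : dot e x + eps * enorm x = enorm x * (dot e (vr x) + eps).
  by rewrite /vr dotZr; field; rewrite gt_eqF.
by rewrite lnM ?posrE //; ring.
Qed.

(* Summing the second derivatives over an orthonormal basis at a critical
   point: since grad P(z).z = P(z), the square |grad P / P|^2 is at least 1. *)
Lemma log_ratio_no_interior_max e (eps alpha : R) h z : (1 < d)%N ->
  1 <= alpha -> 0 < eps -> enorm z = 1 -> 0 < dot e z + eps -> 0 < h z ->
  laplacian h z = - (alpha * (alpha + d%:R - 2) * h z) ->
  (forall i : 'I_d, let v := delta_mx 0 i in
    derivable h z v /\ derivable (fun x => 'D_v h x) z v) ->
  (forall i : 'I_d, dlog_ratio e eps alpha h (delta_mx 0 i) z = 0 /\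
     'D_(delta_mx 0 i) (dlog_ratio e eps alpha h (delta_mx 0 i)) z <= 0) ->
  False.
Proof.
move=> d1 a1 eps0 z1 P0 h0 lap hD crit.
set P := dot e z + eps in P0.
(* [p] is the gradient of the logarithm of the barrier at [z]; Euler's identity for degree one reads
   [dot p z = 1]. *)
have [p pE] : exists p : 'rV[R]_d, p = P^-1 *: (e + eps *: z) by eexists.
have p_i i : p 0 i = (e 0 i + eps * z 0 i) / P by rewrite pE !mxE mulrC.
have zz : dot z z = 1 by exact/enorm1P.
have pz : dot p z = 1 by rewrite pE !dotE zz mulr1 -/P mulVf ?gt_eqF.
have pp1 : 1 <= dot p p.
  by have := dotxx_ge0 (p - z); rewrite !dotE zz (dotC z p) pz; lra.
(* Criticality expresses the logarithmic gradient of [h] through [p] and [z], which removes the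
   first derivatives of [h] from the second-order condition. *)
have fst_i i : 'D_(delta_mx 0 i) h z / h z = alpha * (p 0 i - z 0 i).
  have [+ _] := crit i; rewrite /dlog_ratio !dot_delta z1 !divr1 mulr1 -/P.
  by rewrite p_i => E; rewrite -[LHS]addr0 -E; ring.
have snd_i i : alpha * (eps * (1 - z 0 i ^+ 2) / P - p 0 i ^+ 2)
     - alpha * (1 - 2 * z 0 i ^+ 2)
     - ('D_(delta_mx 0 i) (fun x => 'D_(delta_mx 0 i) h x) z / h z
     - (alpha * (p 0 i - z 0 i)) ^+ 2) <= 0.
  have [_] := crit i; have [D1 D2] := hD i.
  rewrite (@derive_val _ _ _ _ _ _ _ (is_derive_dlog_ratio alpha z1 P0 h0 D1 D2)).
  by rewrite !dot_delta fst_i !mxE !eqxx /= p_i.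
have sum_le0 (T : 'I_d -> R) : (forall i, T i <= 0) -> \sum_i T i <= 0.
  by move=> T0; apply: sumr_le0.
have := sum_le0 _ snd_i; apply/negP; rewrite -ltNge.
have -> : \sum_i (alpha * (eps * (1 - z 0 i ^+ 2) / P - p 0 i ^+ 2)
     - alpha * (1 - 2 * z 0 i ^+ 2)
     - ('D_(delta_mx 0 i) (fun x => 'D_(delta_mx 0 i) h x) z / h z
     - (alpha * (p 0 i - z 0 i)) ^+ 2)) =
  alpha * eps / P * (d%:R - dot z z) - alpha * dot p p
  - alpha * (d%:R - 2 * dot z z) - laplacian h z / h z
  + alpha ^+ 2 * dot (p - z) (p - z).
  have -> : d%:R = \sum_(i < d) (1 : R) by rewrite sumr_const card_ord.
  rewrite /dot /laplacian !mulr_suml !mulr_sumr -!sumrB !mulr_sumr -!sumrB.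
  rewrite -big_split /=; apply: eq_bigr => i _; rewrite !mxE; ring.
have -> : dot (p - z) (p - z) = dot p p - 1 by rewrite !dotE (dotC z p) pz zz; ring.
rewrite lap zz.
have -> : - (alpha * (alpha + d%:R - 2) * h z) / h z = - (alpha * (alpha + d%:R - 2)).
  by field; rewrite gt_eqF.
(* After the substitutions the sum is exactly [alpha * eps / P * (d%:R - 1) + alpha * (alpha - 1) *
   dot p p]: the terms free of [eps] and [dot p p] cancel by the value of the eigenvalue. *)
have a0 : 0 < alpha by rewrite (lt_le_trans ltr01).
have T1 : 0 < alpha * eps / P * (d%:R - 1).
  by rewrite mulr_gt0 ?divr_gt0 ?mulr_gt0 // subr_gt0 ltr1n.
have T2 : 0 <= alpha * (alpha - 1) * dot p p.
  by rewrite !mulr_ge0 ?subr_ge0 // ltW // (lt_le_trans ltr01).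
by rewrite (lt_le_trans T1) // -subr_ge0 (le_trans T2) // le_eqVlt; apply/orP; left; apply/eqP; ring.
Qed.

End LogRatio.

(** * The maximum principle argument for the oblique eigenvalue problem *)

Section ObliqueEigenvalue.
Context {R : realType} {d : nat}.
Variables (S : set 'rV[R]_d) (g n : 'rV[R]_d -> 'rV[R]_d).

Lemma dual_bound : cone_conditions S g n ->
  exists e : 'rV[R]_d, exists2 c : R, 0 < c &
    [/\ enorm e = 1, forall x, closure (cone S) x -> 0 <= dot e x &
        forall z, sbnd S z -> c <= dot e (g z)].
Proof.
case=> _ _ gU _ _ _ _ [e [e1 eN /ereal_inf_gt0P[c c0 ce]]].
exists e; exists c => //; split => // z Sz; apply: ce; split; last exact: gU.
by move=> C [_]; apply; exists z.
Qed.

Lemma oblique_pos : cone_conditions S g n ->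
  forall z, sbnd S z -> dcone S z /\ 0 < dot (g z) (n z).
Proof.
case=> -[SU _] _ gU /ereal_inf_gt0P[c c0 gn] _ _ _ _ z Sz.
have dz := sbnd_dcone SU Sz; split => //.
have := gn z dz; rewrite /hext vr_id; last exact: (closure_usphere SU Sz.1).
exact: lt_le_trans.
Qed.

Lemma oblique_eigenvalue_lt1 (alpha : R) : (1 < d)%N -> cone_conditions S g n ->
  oblique_eigenvalue S g alpha (alpha * (alpha + d%:R - 2)) -> alpha < 1.
Proof.
move=> d1 hc [U [psi [[Uo SU'] psiC psi0 psiE psiB]]].
rewrite ltNge; apply/negP => a1.
have [e [c c0 [e1 eN eg]]] := dual_bound hc.
have [[SU Sdom] hn gU _ _ _ _ _] := hc.
have a0 : 0 < alpha by rewrite (lt_le_trans ltr01).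
(* On the boundary [dot (g z) z >= -1], so the barrier's derivative along [g z] is at least
   [c - eps = c / 2 > 0]. *)
pose eps := c / 2.
have eps0 : 0 < eps by rewrite divr_gt0.
have cl1 z : closure S z -> enorm z = 1 by move=> /(closure_usphere SU).
have P0 z : closure S z -> 0 < dot e z + eps.
  by move=> Sz; rewrite ltr_wpDl //; apply: eN; exact: (closureS (@sub_cone _ _ S)).
pose h := hext psi; pose F := log_ratio e eps alpha h.
have hz z : closure S z -> h z = psi z by move=> /cl1 z1; rewrite /h /hext vr_id.
have psiD z : U z -> differentiable psi z by case: psiC => + _; apply.
have hD z : closure S z -> differentiable h z.
  move=> Sz; apply: differentiable_hext; first exact/enorm1_neq0/cl1.
  by apply: psiD; rewrite vr_id; [exact: SU'|exact: cl1].
have BD z : z != 0 -> differentiable (fun x => dot e x + eps * enorm x) z.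
  move=> z0; apply: differentiableD; first exact: differentiable_dot.
  by apply: differentiableM => //; exact: differentiable_enorm.
have FD z : closure S z -> differentiable F z.
  move=> Sz; have z1 := cl1 z Sz; have z0 := enorm1_neq0 z1.
  apply: differentiableB.
    apply: differentiableB.
      apply: differentiableM => //; apply: differentiable_ln; first exact: BD.
      by rewrite z1 mulr1 P0.
    apply: differentiableM => //; apply: differentiable_ln.
      exact: differentiable_enorm.
    by rewrite z1.
  by apply: differentiable_ln; [exact: hD|rewrite hz // psi0].
have [z zS zmax] : exists2 z, z \in closure S & forall x, x \in closure S -> F x <= F z.
  apply: EVT_max_rV; last 2 first.
  - exact: compact_closure_usphere.
  - apply: continuous_in_subspaceT => x /set_mem Sx.
    exact/differentiable_continuous/FD.
  by have [[x Sx] _ _] := Sdom; exists x; exact: subset_closure.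
move: zS => /set_mem zS.
have z1 := cl1 z zS; have z0 := enorm1_neq0 z1.
(* By 0-homogeneity the maximum over the closure of [S] dominates [F] on the whole cone, so points
   off the sphere can be compared with [z]. *)
have Fmax x : x != 0 -> S (vr x) -> F x <= F z.
  move=> x0 /subset_closure Sx; rewrite /F log_ratio_vr //; last exact: P0.
  by apply: zmax; exact: mem_set.
have Pz : 0 < dot e z + eps * enorm z by rewrite z1 mulr1 P0.
have h0 : 0 < h z by rewrite hz // psi0.
(* At a boundary maximum, a small step along [g z] enters the cone and strictly increases [F], a
   contradiction. *)
have [Sz|nSz] := pselect (S z); last first.
  have bz := closure_sbnd SU zS nSz.
  have [dz gn] := oblique_pos hc bz.
  have inw := inward_cone dz (hn z dz) gn.
  have D : is_derive (0 : R) (1 : R) (fun s => F (z + s *: g z))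
      (dlog_ratio e eps alpha h (g z) z).
    apply: is_derive_line; rewrite scale0r addr0.
    by apply: is_derive_log_ratio => //; apply: diff_derivable; exact: hD.
  have D0 : 0 < dlog_ratio e eps alpha h (g z) z.
    have := dot_unit_le1 (gU z bz) z1; have := eg z bz; have := psiB z bz.
    rewrite /dlog_ratio derive_grad; last exact: hD.
    rewrite -/(sgrad psi) /tangential /radial vr_id // dotDl dotNl dotZl.
    rewrite dot_sgrad_id //; last exact/psiD/SU'.
    rewrite z1 !divr1 mulr1 (dotC z) mulr0 subr0 hz // => E ec /andP[gz _].
    (* The oblique boundary condition turns the derivative of [h] into a term that cancels the one
       coming from [ln (enorm x)]. *)
    have -> : dot (g z) (sgrad psi z) = - (alpha * dot (g z) z * psi z).
      by apply/eqP; rewrite -addr_eq0 addrC E.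
    have psiz : psi z != 0 by rewrite gt_eqF // psi0.
    have Pz' : dot e z + eps != 0 by rewrite gt_eqF // P0.
    have -> : alpha * ((dot e (g z) + eps * dot (g z) z) / (dot e z + eps))
        - alpha * dot (g z) z - - (alpha * dot (g z) z * psi z) / psi z =
        alpha * ((dot e (g z) + eps * dot (g z) z) / (dot e z + eps)).
      by field; apply/andP.
    rewrite mulr_gt0 // divr_gt0 ?P0 //.
    have : eps * -1 <= eps * dot (g z) z by rewrite ler_pM2l.
    by rewrite /eps; lra.
  have /near_right_ex[t [+ /(coneP _ SU)[t0 St]]] : \forall t \near (0 : R)^'+,
      F (z + (0 : R) *: g z) < F (z + t *: g z) /\ cone S (z + t *: g z).
    exact: filterI (gt0_derive_right D D0) inw.
  rewrite scale0r addr0 => lt.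
  by have := Fmax _ t0 St; rewrite leNgt lt.
(* At an interior maximum the cone contains a neighbourhood of [z], so the one-variable conditions
   hold along every coordinate direction. *)
have zS' := sphere_domain_near SU Sdom Sz.
have zn : \forall x \near z, 0 < dot x x.
  by apply: (cvgr_gt _ (@continuous_dot _ _ z)); rewrite dotxx_gt0.
have zP : \forall x \near z, 0 < dot e x + eps * enorm x.
  exact: (cvgr_gt _ (differentiable_continuous (BD z z0))).
have hv (i : 'I_d) : derivable h z (delta_mx 0 i) /\
    derivable (fun x => 'D_(delta_mx 0 i) h x) z (delta_mx 0 i).
  split; first exact/diff_derivable/hD.
  by apply: derivable_derive_hext Uo psiC z1 _; exact: SU'.
apply: (@log_ratio_no_interior_max _ _ e eps alpha h z) => //.
- exact: P0.
- by apply/eqP; rewrite -addr_eq0 addrC hz //; apply/eqP; exact: psiE.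
move=> i; set v := delta_mx 0 i; have [vD v2D] := hv i.
have [] := @local_max_derive2 _ (fun t => F (z + t *: v))
  (fun t => dlog_ratio e eps alpha h v (z + t *: v)) ('D_v (dlog_ratio e eps alpha h v) z).
- have : \forall x \near z, is_derive x v F (dlog_ratio e eps alpha h v x).
    apply: filterS3 zS' zn zP => x Sx; rewrite dotxx_gt0 => x0 Px.
    have Sx' := subset_closure Sx.
    apply: is_derive_log_ratio => //; first by rewrite /h /hext psi0.
    apply/diff_derivable/differentiable_hext => //.
    exact/psiD/SU'.
  by move/(near_line v); apply: filterS => t; exact: is_derive_line.
- apply: is_derive_line; rewrite scale0r addr0; apply: derivableP.
  by apply: ex_derive; apply: is_derive_dlog_ratio => //; exact: P0.
- have : \forall x \near z, F x <= F z.
    by apply: filterS2 zS' zn => x Sx; rewrite dotxx_gt0 => x0; exact: Fmax.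
  by move/(near_line v); rewrite scale0r addr0.
by rewrite scale0r addr0.
Qed.

End ObliqueEigenvalue.

(** * Plane polar coordinates, signed angles and the sides of a sector *)

Section Planar.
Context {R : realType}.
Implicit Types (x y u v e : 'rV[R]_2) (r s t theta phi zeta sigma : R).

Lemma dot2E x y : dot x y = x 0 0 * y 0 0 + x 0 1 * y 0 1.
Proof.
rewrite /dot big_ord_recl big_ord_recl big_ord0 addr0.
by congr (x 0 _ * y 0 _ + x 0 _ * y 0 _); apply: val_inj.
Qed.

Lemma polar0E r theta : (polar r theta : 'rV[R]_2) 0 0 = r * cos theta.
Proof. by rewrite mxE. Qed.

Lemma polar1E r theta : (polar r theta : 'rV[R]_2) 0 1 = r * sin theta.
Proof. by rewrite mxE. Qed.

Lemma rV2P x y : x 0 0 = y 0 0 -> x 0 1 = y 0 1 -> x = y.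
Proof.
move=> E0 E1; apply/rowP => -[[|[|//]] i2].
- by rewrite (_ : Ordinal i2 = 0) //; apply: val_inj.
- by rewrite (_ : Ordinal i2 = 1) //; apply: val_inj.
Qed.

Lemma dot_polar r s theta phi :
  dot (polar r theta : 'rV[R]_2) (polar s phi) = r * s * cos (theta - phi).
Proof. by rewrite dot2E !polar0E !polar1E cosB; ring. Qed.

Lemma enorm_polar1 theta : enorm (polar 1 theta : 'rV[R]_2) = 1.
Proof. by apply/enorm1P; rewrite dot_polar subrr cos0 !mulr1. Qed.

(** Parseval's identity in the orthonormal frame made of a direction and its quarter turn, the
    latter taken up to the sign [sigma]. *)
Lemma polar_frame u v theta sigma : sigma ^+ 2 = 1 ->
  dot u v = dot u (polar 1 theta) * dot v (polar 1 theta) +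
    dot u (sigma *: polar 1 (theta + pi / 2)) * dot v (sigma *: polar 1 (theta + pi / 2)).
Proof.
move=> s2; rewrite !dotZr mulrACA -expr2 s2 mul1r !dot2E !polar0E !polar1E.
rewrite cosDpihalf sinDpihalf !mul1r -[LHS]mulr1 -(cos2Dsin2 theta); ring.
Qed.

(** The half-angle formula gives [1 - cos t = 2 sin^2 (|t| / 2)], and [|t| / 2] lies strictly
    between 0 and [pi]. *)
Lemma cos_lt1 t : 0 < `|t| < 2 * pi -> cos t != 1.
Proof.
rewrite -(cos_norm t) => /andP[t0 t2].
have -> : `|t| = (`|t| / 2) *+ 2 by rewrite -mulr_natr; field.
rewrite cos_mulr2n cos2sin2.
have : 0 < sin (`|t| / 2).
  by apply: sin_gt0_pi; rewrite divr_gt0 //= ltr_pdivrMr // mulrC.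
move=> s0; have : 0 < sin (`|t| / 2) ^+ 2 by rewrite exprn_gt0.
by move=> s2; apply/eqP => E; move: E s2; rewrite -mulr_natr; lra.
Qed.

(** For a unit vector [u] and an orthonormal frame [v], [m], the second hypothesis is Pythagoras'
    identity. The sign convention is what makes the sine equal to [- dot u v] in both cases. *)
Lemma signed_angleP u m v : 0 < dot u m ->
  dot u v ^+ 2 + dot u m ^+ 2 = 1 ->
  [/\ - (pi / 2) < signed_angle u m v < pi / 2,
      cos (signed_angle u m v) = dot u m & sin (signed_angle u m v) = - dot u v].
Proof.
set a := dot u m; set b := dot u v => a0 ab.
have a1 : -1 <= a <= 1 by have := sqr_ge0 b; nra.
have ca : cos (acos a) = a by rewrite acosK // in_itv.
have sa : sin (acos a) = `|b| by rewrite sin_acos // -ab addrK sqrtr_sqr.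
have p0 := pi_gt0 R.
have A0 : 0 <= acos a by exact: acos_ge0.
have A2 : acos a < pi / 2.
  rewrite -ltr_cos ?cos_pihalf ?ca // in_itv /=; last by lra.
  by rewrite A0 acos_lepi.
rewrite /signed_angle -/a -/b; case: (ltP b 0) => b0.
  by split => //; [lra|rewrite sa ltr0_norm].
by split; rewrite ?cosN ?sinN ?sa ?ger0_norm //; lra.
Qed.

Lemma lt0_sin_gtNpi t : - pi < t -> 0 < sin t -> 0 < t.
Proof.
move=> tp; apply: contraTT; rewrite -!leNgt => t0.
by rewrite -oppr_ge0 -sinN sin_ge0_pi //; lra.
Qed.

(* One side of the sector: its direction is [theta], and the interior lies at
   the angles [theta + sigma * s]; thus (theta, sigma) is (0, 1) or (zeta, -1). *)
Section SectorSide.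
Variables (S : set 'rV[R]_2) (theta sigma zeta : R).
Hypothesis (sigma2 : sigma = 1 \/ sigma = -1) (zeta0 : 0 < zeta).
Hypothesis side_in : forall r s, 0 < r -> 0 < s < zeta ->
  cone S (polar r (theta + sigma * s)).
Hypothesis side_out : ~ cone S (polar 1 theta).

Let x : 'rV[R]_2 := polar 1 theta.
Let w : 'rV[R]_2 := sigma *: polar 1 (theta + pi / 2).

Let sqr_sigma : sigma ^+ 2 = 1.
Proof. by case: sigma2 => ->; rewrite ?sqrrN expr1n. Qed.

(** The point is [(1 + t * lambda) *: x + t *: w]; for small positive [t] its angle from the side,
    measured inwards, is [atan (t / (1 + t * lambda))], which lies strictly between 0 and [zeta]. *)
Lemma side_cone (lambda : R) :
  \forall t \near (0 : R)^'+, cone S (x + t *: (w + lambda *: x)).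
Proof.
have near0 (f : R -> R) (c : R) : {for 0, continuous f} -> f 0 < c ->
    \forall t \near (0 : R)^'+, f t < c.
  move=> fc f0; have := cvg_at_right_filter fc.
  by move=> fr; exact: (cvgr_lt _ fr).
have D : {for 0, continuous (fun t : R => 1 + t * lambda)}.
  apply: cvgD; first exact: cvg_cst.
  by apply: cvgM; [exact: cvg_id|exact: cvg_cst].
have A1 : \forall t \near (0 : R)^'+, - (1 + t * lambda) < 0.
  apply: (near0 (fun t => - (1 + t * lambda))); first exact: cvgN.
  by rewrite mul0r addr0 oppr_lt0.
have A2 : \forall t \near (0 : R)^'+, atan (t / (1 + t * lambda)) < zeta.
  apply: (near0 (fun t => atan (t / (1 + t * lambda)))); last by rewrite mul0r atan0.
  apply: (@continuous_comp _ _ _ (fun t : R => t / (1 + t * lambda)) atan).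
    apply: cvgM; first exact: cvg_id.
    by apply: cvgV => //; rewrite mul0r addr0 oner_neq0.
  exact: continuous_atan.
have A3 : \forall t \near (0 : R)^'+, 0 < t by exact: nbhs_right_gt.
apply: filterS3 A1 A2 A3 => t; rewrite oppr_lt0 => k0; set y := t / _ => yz t0.
have y0 : 0 < y by rewrite divr_gt0.
have at0 : 0 < atan y by rewrite -(atan0 R) lt_atan.
have ca0 : 0 < cos (atan y) by apply: cos_gt0_pihalf; rewrite atan_gtNpi2 atan_ltpi2.
have sa : sin (atan y) = y * cos (atan y).
  by rewrite -{2}(atanK y) /tan divfK // gt_eqF.
suff -> : x + t *: (w + lambda *: x) =
    polar ((1 + t * lambda) / cos (atan y)) (theta + sigma * atan y).
  by apply: side_in; rewrite ?divr_gt0 ?at0.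
have csig : cos (sigma * atan y) = cos (atan y).
  by case: sigma2 => ->; rewrite ?mul1r // mulN1r cosN.
have ssig : sin (sigma * atan y) = sigma * sin (atan y).
  by case: sigma2 => ->; rewrite ?mul1r // !mulN1r sinN.
apply: rV2P.
  rewrite /x /w !mxE /= cosDpihalf cosD csig ssig sa !mul1r.
  by move: (cos (atan y)) ca0 => C C0; rewrite /y; field; rewrite !gt_eqF.
rewrite /x /w !mxE /= sinDpihalf sinD csig ssig sa !mul1r.
by move: (cos (atan y)) ca0 => C C0; rewrite /y; field; rewrite !gt_eqF.
Qed.

Lemma side_closure : closure (cone S) x.
Proof.
move=> B xB; have := side_cone 0; rewrite scale0r addr0 => wc.
have wB := near_line w xB.
have /near_right_ex[t [? ?]] : \forall t \near (0 : R)^'+,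
    cone S (x + t *: w) /\ B (x + t *: w).
  by apply: filterI => //; apply: cvg_within; exact: wB.
by exists (x + t *: w).
Qed.

Lemma side_sbnd : S `<=` @usphere R 2 -> sbnd S x.
Proof.
move=> SU; apply: closure_sbnd => //; last first.
  by move=> Sx; apply: side_out; exact: sub_cone.
move=> B xB; have := near_vr (enorm_polar1 theta) xB.
move=> /side_closure[y [/(coneP _ SU)[_ Sy] By]].
by exists (vr y).
Qed.

(* [x + t *: (w + lambda *: x)] enters the cone for every real [lambda], so
   [dot w n + lambda * dot x n] is nonnegative for all [lambda]. *)
Lemma side_normal n : dcone S x -> unit_inward_normal (cone S) x n -> n = w.
Proof.
move=> [bx _] [n1 [U [rho [Uo Ux [rd _] rhoE [c c0 gE]]]]].
have rx : rho x = 0 by apply/(rhoE x Ux).2.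
have dir_ge0 lambda : 0 <= dot w n + lambda * dot x n.
  set v := w + lambda *: x.
  have -> : dot w n + lambda * dot x n = dot v n by rewrite !dotE.
  rewrite leNgt; apply/negP => vn.
  (* If [dot v n] were negative, [rho] would become negative along [v], although these points lie in
     the cone, where [rho] is positive. *)
  pose f s := - rho (x + s *: v).
  have D : is_derive (0 : R) (1 : R) f (- 'D_v rho x).
    apply: is_deriveN; apply: is_derive_line; rewrite scale0r addr0.
    by apply: derivableP; apply: diff_derivable; exact: rd.
  have D0 : 0 < - 'D_v rho x.
    by rewrite derive_grad ?gE ?dotZr ?oppr_gt0 ?pmulr_rlt0 //; exact: rd.
  have xU : \forall t \near (0 : R)^'+, U (x + t *: v).
    by apply: cvg_within; apply: near_line; exact: open_nbhs_nbhs.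
  have fU : \forall t \near (0 : R)^'+, [/\ f 0 < f t, U (x + t *: v) & cone S (x + t *: v)].
    by apply: filterS3 (gt0_derive_right D D0) xU (side_cone lambda).
  have [t [ft Ut /(rhoE _ Ut).1 rt]] := near_right_ex fU.
  move: ft; rewrite /f scale0r addr0 rx oppr0 oppr_gt0.
  by rewrite ltNge ltW.
have xn : dot x n = 0.
  apply/eqP; apply/negPn/negP => xn.
  (* This choice of [lambda] makes the nonnegative quantity equal to -1. *)
  have := dir_ge0 (- (dot w n + 1) / dot x n).
  by rewrite divfK // opprD addNKr oppr_ge0 ler10.
have wn : 0 <= dot w n by have := dir_ge0 0; rewrite mul0r addr0.
have fr u v := polar_frame u v theta sqr_sigma.
(* The unit vector [n] is orthogonal to [x], so its component along [w] is 1 up to sign, and [wn]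
   fixes the sign. Then [n - w] has norm zero. *)
have wn1 : dot w n = 1.
  apply/eqP; rewrite -(sqrp_eq1 wn); apply/eqP; rewrite -((enorm1P n).1 n1).
  by rewrite (fr n n) -/x -/w (dotC n x) xn mul0r add0r (dotC n w) expr2.
have ww : dot w w = 1.
  by rewrite !dotE dot_polar subrr cos0 !mulr1 -expr2.
apply/eqP; rewrite -subr_eq0 -dotxx_eq0 !(dotDl, dotDr, dotNl, dotNr) (dotC n w) wn1 ww.
by rewrite (enorm1P n).1 // opprK addNr addr0 subrr.
Qed.

(** With [om = sigma * (phi - theta)] and signed angle [A], the frame expansion gives
    [dot e (g x) = sin (om - A) > 0]. Since [om - A > - pi], positivity of the sine forces
    [A < om]. *)
Lemma side_angle g n e phi : cone_conditions S g n ->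
  0 < dot e (g x) -> e = polar 1 phi ->
  - (pi / 2) <= sigma * (phi - theta) <= pi / 2 ->
  signed_angle (g x) (n x) x < sigma * (phi - theta).
Proof.
move=> hc eg eE w2; have [[SU _] hn gU _ _ _ _ _] := hc.
have sx := side_sbnd SU; have [dx gn] := oblique_pos hc sx.
rewrite (side_normal dx (hn x dx)) in gn *.
have fr u v := polar_frame u v theta sqr_sigma.
have gg := (enorm1P (g x)).1 (gU x sx).
have [] := @signed_angleP (g x) w x gn.
  by rewrite -[RHS]gg (fr (g x) (g x)) -/x -/w !expr2.
set A := signed_angle _ _ _ => A2 cA sA.
set om := sigma * (phi - theta) in w2 *.
have ex : dot e x = cos om.
  rewrite eE dot_polar !mul1r /om; case: sigma2 => ->; first by rewrite mul1r.
  by rewrite mulN1r cosN.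
have ew : dot e w = sin om.
  rewrite eE dotZr dot_polar !mul1r /om opprD addrA cosBpihalf.
  by case: sigma2 => ->; rewrite ?mul1r // !mulN1r sinN.
rewrite -subr_gt0; apply: lt0_sin_gtNpi; first by lra.
by move: eg; rewrite (fr e (g x)) -/x -/w ex ew sinB cA sA; lra.
Qed.

End SectorSide.

(** * The bound in dimension two *)

Lemma alpha_star_planar_lt1 (S : set 'rV[R]_2) g n alpha :
  cone_conditions S g n -> alpha_star_planar S g n alpha -> alpha < 1.
Proof.
move=> hc [zeta [[/andP[z0 z2p] KE] ->]].
have [e [c c0 [e1 eN eg]]] := dual_bound hc.
have [[SU _] _ _ _ _ _ _ _] := hc.
have p0 := pi_gt0 R.
have inK r s : 0 < r -> 0 < s < zeta -> cone S (polar r s).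
  by move=> r0 sz; rewrite KE; exists r, s.
(* A polar representation of the unit vector of a side with an angle [s] inside the sector would
   have radius 1 and [cos (theta - s) = 1], impossible for [0 < |theta - s| < 2 * pi]. *)
have outK theta : theta = 0 \/ theta = zeta -> ~ cone S (polar 1 theta).
  rewrite KE => th [r [s [r0 /andP[s0 sz] E]]].
  have := congr1 (fun y => dot y y) E; rewrite !dot_polar !subrr cos0 !mulr1 => r1.
  have {}r1 : r = 1.
    by apply/eqP; rewrite -(sqrp_eq1 (ltW r0)) expr2 -r1.
  have := congr1 (fun y => dot y (polar 1 theta)) E.
  rewrite !dot_polar r1 subrr cos0 !mulr1 mul1r => /esym; apply/eqP.
  apply: cos_lt1; case: th => ->; first by rewrite subr0 gtr0_norm // s0 (lt_trans sz).
  by rewrite ltr0_norm ?subr_lt0 //; lra.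
have in1 r s : 0 < r -> 0 < s < zeta -> cone S (polar r (0 + 1 * s)).
  by rewrite add0r mul1r; exact: inK.
have in2 r s : 0 < r -> 0 < s < zeta -> cone S (polar r (zeta + -1 * s)).
  by move=> r0 sz; apply: inK => //; lra.
have out1 := outK 0 (or_introl erefl); have out2 := outK zeta (or_intror erefl).
have ee : e 0 0 ^+ 2 + e 0 1 ^+ 2 = 1 by rewrite -((enorm1P e).1 e1) dot2E !expr2.
have e00 : 0 <= e 0 0.
  have := eN _ (side_closure (or_introl erefl) z0 in1).
  by rewrite dot2E polar0E polar1E cos0 sin0 !mulr0 addr0 !mulr1.
have e01 : -1 <= e 0 1 <= 1 by have := sqr_ge0 (e 0 0); nra.
(* The arcsine is the right branch because the first side lies in the closed cone, whence
   [0 <= e 0 0]. *)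
pose phi := asin (e 0 1).
have phi2 : - (pi / 2) <= phi <= pi / 2 by rewrite asin_geNpi2 // asin_lepi2.
have eE : e = polar 1 phi.
  apply: rV2P; rewrite ?polar0E ?polar1E mul1r; last by rewrite asinK // in_itv.
  by rewrite cos_asin // -ee addrK sqrtr_sqr ger0_norm.
have zphi : zeta - phi <= pi / 2.
  rewrite leNgt; apply/negP => zp.
  (* A direction of the closed sector making an angle in []pi / 2, pi]] with [e], hence a negative
     inner product. The cap [phi + pi] is there because the cosine is no longer negative once the
     angle reaches [3 * pi / 2]. *)
  pose th := Num.min zeta (phi + pi).
  have thz : th <= zeta by rewrite ge_min lexx.
  have thp : th <= phi + pi by rewrite ge_min lexx orbT.
  have th1 : phi + pi / 2 < th by rewrite lt_min; lra.
  have clth : closure (cone S) (polar 1 th).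
    have [->|thz'] := eqVneq th zeta.
      exact: (side_closure (or_intror erefl) z0 in2).
    have thl : th < zeta by rewrite lt_neqAle thz' thz.
    by apply: subset_closure; apply: inK => //; rewrite thl andbT; lra.
  have := eN _ clth; rewrite eE dot_polar !mul1r -cosN opprB.
  have -> : th - phi = (th - phi - pi) + pi by ring.
  rewrite cosDpi oppr_ge0 leNgt cos_gt0_pihalf //; lra.
rewrite ltr_pdivrMr // mul1r.
have s1 : sbnd S (polar 1 0) := side_sbnd (or_introl erefl) z0 in1 out1 SU.
have s2 : sbnd S (polar 1 zeta) := side_sbnd (or_intror erefl) z0 in2 out2 SU.
have := side_angle (or_introl erefl) z0 in1 out1 hc (lt_le_trans c0 (eg _ s1)) eE.
have := side_angle (or_intror erefl) z0 in2 out2 hc (lt_le_trans c0 (eg _ s2)) eE.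
rewrite subr0 mul1r mulN1r opprB => A2 A1.
(* The remaining bound [- (pi / 2) <= zeta - phi] comes from [phi <= pi / 2] and [0 < zeta]. *)
have {}A1 := A1 phi2; have {}A2 : signed_angle (g (polar 1 zeta)) (n (polar 1 zeta))
  (polar 1 zeta) < zeta - phi by apply: A2; lra.
by lra.
Qed.

End Planar.

Unset Implicit Arguments.
Set Strict Implicit.

Theorem theoremA10 (R : realType) (d : nat) (hd : (2 <= d)%N)
    (S : set 'rV[R]_d) (g n : 'rV[R]_d -> 'rV[R]_d)
    (hc : cone_conditions S g n)
    (alpha : R) (halpha : is_alpha_star S g n alpha) :
  alpha < 1.
Proof.
case: halpha => [[d2 planar]|[_ [lambda [lambdaE [[_ [_ lambda_eq]]|[_ ->]]]]]].
- by subst d; exact: alpha_star_planar_lt1 hc planar.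
- by apply: (oblique_eigenvalue_lt1 hd hc); rewrite -lambda_eq.
- exact: ltr01.
Qed.
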